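(* Let $E$ be a complex inner product space. For all nonzero vectors $x, y \in E$, we have $$\operatorname{Re} (x, y) = \|x\|\|y\|\left(1 - \frac12 \left\|\frac{x}{\|x\|}-\frac{y}{\|y\|}\right\|^2\right)$$ and $$\operatorname{Im} (x, y) = \|x\|\|y\|\left(1 - \frac12 \left\|\frac{x}{\|x\|}-\frac{i y}{\|y\|}\right\|^2\right).$$
   Context: The inner product $(x,y)$ is linear in the first argument and conjugate linear in the second, and $\|x\| = \sqrt{(x,x)}$. *)

(* Defs.v *)
From mathcomp Require Import all_boot all_order all_algebra.
From mathcomp Require Import complex reals.

Set Implicit Arguments.
Unset Strict Implicit.
Unset Printing Implicit Defensive.

Import GRing.Theory Num.Theory.
Local Open Scope ring_scope.

(* The inner product of a vector with itself is a nonnegative element of R[i],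
   hence real: its real part is the whole value, viewed in R. *)
Definition dot_norm (R : realType) (E : lmodType R[i])
  (form : {dot E for @Num.conj R[i]}) (x : E) : R :=
  Num.sqrt (complex.Re (form x x)).

(* Main.v *)
Require Import Defs.
From mathcomp Require Import all_boot all_order all_algebra.
From mathcomp Require Import complex reals ring.

Import GRing.Theory Num.Theory.
Local Open Scope ring_scope.
Local Open Scope complex_scope.

(* For a = |x|^-1 and b = |y|^-1, expanding |a x - b y|^2 gives
   2 - 2 Re (x, y) / (|x| |y|), which is the first identity. Since
   Im (x, y) = Re (x, i y) and |i y| = |y|, the second one is the first one
   applied to x and i y. *)

Section DotNorm.
Variables (R : realType) (E : lmodType R[i]) (form : {dot E for @Num.conj R[i]}).
Implicit Types (x y : E) (a b : R).

(** The order on [R[i]] makes [0 <= form x x] include a nonnegative real part, so [Num.sqrt] does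
    not fall back to its default value 0. *)
Lemma dot_norm_sqr x : dot_norm form x ^+ 2 = complex.Re (form x x).
Proof.
by rewrite /dot_norm sqr_sqrtr //; have := dnorm_ge0 form x; rewrite lecE /= => /andP[].
Qed.

Lemma dot_norm_gt0 x : x != 0 -> 0 < dot_norm form x.
Proof. by move=> x0; rewrite sqrtr_gt0; have := x0; rewrite -(dnorm_gt0 form) ltcE => /andP[]. Qed.

Lemma dotC x y : form y x = conjc (form x y).
Proof. by rewrite (hermC form y x) expr0 mul1r. Qed.

Lemma dotZr (c : R[i]) x y : form x (c *: y) = conjc c * form x y.
Proof. exact: linearZr_LR. Qed.

(** Real scalars are fixed by conjugation, and the two cross terms are conjugate, so they add up to
    twice a real part. *)
Lemma dot_norm_sqrB a b x y :
  dot_norm form (a%:C *: x - b%:C *: y) ^+ 2 =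
  a ^+ 2 * dot_norm form x ^+ 2 + b ^+ 2 * dot_norm form y ^+ 2
  - 2 * a * b * complex.Re (form x y).
Proof.
rewrite !dot_norm_sqr linearBl !linearBr /= !linearZl_LR /= !dotZr (dotC x y).
by case: (form x x) (form y y) (form x y) => [? ?] [? ?] [? ?] /=; ring.
Qed.

(** Conjugate linearity in the second argument brings out the factor -i, and Re (-i z) = Im z. *)
Lemma Re_dot_iZ x y : complex.Re (form x ('i%C *: y)) = complex.Im (form x y).
Proof. by rewrite dotZr; case: (form x y) => ? ? /=; ring. Qed.

Lemma dot_norm_iZ y : dot_norm form ('i%C *: y) = dot_norm form y.
Proof.
rewrite /dot_norm linearZl_LR /= dotZr.
by congr Num.sqrt; case: (form y y) => ? ? /=; ring.
Qed.

Lemma Re_dotE x y : x != 0 -> y != 0 ->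
  complex.Re (form x y) =
    dot_norm form x * dot_norm form y *
    (1 - 1 / 2 *
       dot_norm form ((dot_norm form x)^-1%:C *: x
                      - (dot_norm form y)^-1%:C *: y) ^+ 2).
Proof.
move=> /dot_norm_gt0/lt0r_neq0 x0 /dot_norm_gt0/lt0r_neq0 y0.
by rewrite dot_norm_sqrB; field; rewrite x0 y0.
Qed.

End DotNorm.

Theorem theorem2p1 (R : realType) (E : lmodType R[i])
    (form : {dot E for @Num.conj R[i]}) (x y : E) (hx : x != 0) (hy : y != 0) :
  complex.Re (form x y) =
    dot_norm form x * dot_norm form y *
    (1 - 1 / 2 *
       dot_norm form ((dot_norm form x)^-1%:C *: x
                      - (dot_norm form y)^-1%:C *: y) ^+ 2)
  /\
  complex.Im (form x y) =
    dot_norm form x * dot_norm form y *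
    (1 - 1 / 2 *
       dot_norm form ((dot_norm form x)^-1%:C *: x
                      - (dot_norm form y)^-1%:C *: ('i%C *: y)) ^+ 2).
Proof.
split; first exact: Re_dotE.
(* Every |y|, also the inverted one, becomes |i y|, so that the goal is literally [Re_dotE] at x and
   i y; what remains is that i y is nonzero. *)
rewrite -Re_dot_iZ -[dot_norm form y]dot_norm_iZ; apply: Re_dotE => //.
by rewrite scaler_eq0 negb_or hy andbT eq_complex /= oner_eq0 andbF.
Qed.
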